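(* Let Assumption 1 (stated in the context) hold for the ensemble filter described in the context with step size $h$, and let $(P_t)_{t\in[0,T]}$ be the continuous-time $d\times d$ symmetric positive semidefinite matrix-valued process satisfying the Riccati equation $$\mathrm dP_t=\left(AP_t+P_tA^T+Q-P_tG^TC^{-1}GP_t\right)\mathrm dt .$$ If $\|P_0-P_0^{a}\|\in O(h)$ as $h\to0$, then $$\sup_{t\in[0,T]}\left\|P_t-P^{f}_{\nu(t)}\right\|\in O(h)\qquad\text{and}\qquad \sup_{t\in[0,T]}\left\|P_t-P^{a}_{\nu(t)}\right\|\in O(h).$$
   Context: Fix $T>0$, $d,p\ge1$, ensemble size $M\ge2$, $A\in\mathbb R^{d\times d}$, $G\in\mathbb R^{p\times d}$, and symmetric positive definite $Q\in\mathbb R^{d\times d}$, $C\in\mathbb R^{p\times p}$. $\|\cdot\|$ is the Euclidean norm of vectors or operator norm of matrices, $\|\cdot\|_F$ the Frobenius norm, $Q^{1/2}$ the symmetric square root. For $h=T/L$, $L\in\mathbb N$, put $t_k=kh$, $k=0,\dots,L$; for $t\in[t_k,t_{k+1})$ let $\nu(t)=k$ (so $\nu(T)=L$). The data $A,G,Q,C,T,M$ do not depend on $h$; $O(h)$ refers to $h\to0$. Ensemble filter with deterministic model perturbations (for each $h$). Starting from an initial ensemble $X^{(i),a}_{t_0}\in\mathbb R^d$, $i=1,\dots,M$, for $k=1,\dots,L$: Forecast: $X^{(i),f}_{t_k}=X^{(i),a}_{t_{k-1}}+hAX^{(i),a}_{t_{k-1}}+hQ^{1/2}\hat W^{(i),h}_k$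 with model perturbations $\hat W_k^{(i),h}\in\mathbb R^d$. Write $\bar x_k^{f},\bar x_k^{a}$ for the ensemble means, e.g. $\bar x^a_k=\frac1M\sum_iX^{(i),a}_{t_k}$, and $P_k^f,P_k^a$ for the ensemble covariances, e.g. $P^a_k=\frac1{M-1}\sum_i(X^{(i),a}_{t_k}-\bar x^a_k)(X^{(i),a}_{t_k}-\bar x^a_k)^T$. Let $K_k=P_k^fG^T(C+hGP_k^fG^T)^{-1}$. Update (Ensemble Square Root Filter): the forecast ensemble is transformed into an ensemble $X^{(i),a}_{t_k}$ whose covariance satisfies $P_k^a=(\mathrm{Id}-hK_kG)P_k^f$ exactly (and whose mean is $\bar x_k^a=\bar x_k^f+K_k(\Delta Y_k-hG\bar x_k^f)$, where $\Delta Y_k\in\mathbb R^p$ is the observation). Convention: $P_0^f:=P_0^a$. Assumption 1: there is a constant $\kappa$ independent of $k$ and $h$ such that for all $k=1,\dots,L$, with $\hat w^h_k=\frac1M\sum_i\hat W^{(i),h}_k$: (i) $\frac1{M-1}\sum_{i=1}^M(X^{(i),a}_{t_{k-1}}-\bar x^a_{k-1})(\hat W^{(i),h}_k-\hat w^h_k)^TQ^{1/2}=\frac12Q$; (ii) $\left\|\frac1{M-1}\sum_{i=1}^MQ^{1/2}(\hat W^{(i),h}_k-\hat w^h_k)(\hat W^{(i),h}_k-\hat w^h_k)^TQ^{1/2}\right\|_F\le\kappa$; (iii) $\hat w_k^h=0$. The statement is understood for a fixed realization of the initial ensembles and of the observations. *)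

(* Defs.v *)
From HB Require Import structures.
From mathcomp Require Import all_boot all_order all_algebra.
From mathcomp Require Import all_classical all_reals all_analysis.

Set Implicit Arguments.
Unset Strict Implicit.
Unset Printing Implicit Defensive.

Import Order.TTheory GRing.Theory Num.Theory.
Import numFieldNormedType.Exports.

Local Open Scope classical_set_scope.
Local Open Scope ring_scope.

Section MatrixNorms.
Context {R : realType}.

Definition euclid_norm {n : nat} (x : 'cV[R]_n) : R :=
  Num.sqrt (\sum_i x i 0 ^+ 2).

(* The library norm on matrices is the max norm.  The set below is nonempty
   and bounded, so the real-valued [sup] is its genuine supremum. *)
Definition opnorm {m n : nat} (A : 'M[R]_(m, n)) : R :=
  sup [set euclid_norm (A *m x) | x in [set x | euclid_norm x <= 1]].

Definition frobenius_norm {m n : nat} (A : 'M[R]_(m, n)) : R :=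
  Num.sqrt (\sum_i \sum_j A i j ^+ 2).

Definition sym_posdef {n : nat} (A : 'M[R]_n) : Prop :=
  A^T = A /\ forall x : 'cV[R]_n, x != 0 -> 0 < (x^T *m A *m x) 0 0.

Definition sym_possemidef {n : nat} (A : 'M[R]_n) : Prop :=
  A^T = A /\ forall x : 'cV[R]_n, 0 <= (x^T *m A *m x) 0 0.

(* [S] is the (unique) symmetric positive semidefinite square root of [Q]. *)
Definition is_sqrtmx {n : nat} (Q S : 'M[R]_n) : Prop :=
  sym_possemidef S /\ S *m S = Q.

End MatrixNorms.

Section Ensembles.
Context {R : realType} {M d : nat}.
Implicit Type X : 'I_M -> 'cV[R]_d.

Definition ens_mean X : 'cV[R]_d := M%:R^-1 *: \sum_i X i.

Definition ens_cov X : 'M[R]_d :=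
  (M%:R - 1)^-1 *: \sum_i (X i - ens_mean X) *m (X i - ens_mean X)^T.

End Ensembles.

Section EnsembleFilter.
Context {R : realType} {d p M : nat}.
Variables (A : 'M[R]_d) (G : 'M[R]_(p, d)) (Q Qhalf : 'M[R]_d) (C : 'M[R]_p).

Definition kalman_gain (h : R) (P : 'M[R]_d) : 'M[R]_(d, p) :=
  P *m G^T *m invmx (C + h *: (G *m P *m G^T)).

(* For one step size [h] with [L] steps, [Xa k], [Xf k] are the analysis and
   forecast ensembles at time [k h], and [W k], [dY k] the perturbations and
   the observation of step [k].  The values [Xf 0], [W 0], [dY 0] are unused. *)
Definition ensemble_srf (h : R) (L : nat)
    (Xa Xf W : nat -> 'I_M -> 'cV[R]_d) (dY : nat -> 'cV[R]_p) : Prop :=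
  forall k : nat, (1 <= k <= L)%N ->
    let Pf := ens_cov (Xf k) in
    let K := kalman_gain h Pf in
    [/\ forall i, Xf k i =
          Xa k.-1 i + h *: (A *m Xa k.-1 i) + h *: (Qhalf *m W k i),
        ens_cov (Xa k) = (1%:M - h *: (K *m G)) *m Pf
      & ens_mean (Xa k) =
          ens_mean (Xf k) + K *m (dY k - h *: (G *m ens_mean (Xf k)))].

Definition perturbation_assumption (kappa : R) (L : nat)
    (Xa W : nat -> 'I_M -> 'cV[R]_d) : Prop :=
  forall k : nat, (1 <= k <= L)%N ->
    let x := ens_mean (Xa k.-1) in
    let w := ens_mean (W k) in
    [/\ (M%:R - 1)^-1 *: (\sum_i (Xa k.-1 i - x) *m (W k i - w)^T *m Qhalf)
          = 2^-1 *: Q,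
        frobenius_norm ((M%:R - 1)^-1 *:
          \sum_i Qhalf *m (W k i - w) *m (W k i - w)^T *m Qhalf) <= kappa
      & w = 0].

Definition analysis_cov (Xa : nat -> 'I_M -> 'cV[R]_d) (k : nat) : 'M[R]_d :=
  ens_cov (Xa k).

(* Convention: the forecast covariance at time 0 is the analysis one. *)
Definition forecast_cov (Xa Xf : nat -> 'I_M -> 'cV[R]_d) (k : nat) : 'M[R]_d :=
  if k is 0%N then ens_cov (Xa 0%N) else ens_cov (Xf k).

Definition riccati_rhs (P : 'M[R]_d) : 'M[R]_d :=
  A *m P + P *m A^T + Q - P *m G^T *m invmx C *m G *m P.

(* Classical solution on [0, T]: the derivative is required in the interior
   and continuity up to the endpoints; values of [P] outside [0, T] are
   irrelevant.  The matrix topology is the entrywise one. *)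
Definition riccati_solution (T : R) (P : R -> 'M[R]_d) : Prop :=
  [/\ forall t, t \in `[0, T] -> sym_possemidef (P t),
      {within `[0, T], continuous P}
    & forall t : R, t \in `]0, T[ -> is_derive t 1 P (riccati_rhs (P t))].

End EnsembleFilter.

Section StepSizes.
Context {R : realType}.

Definition step (T : R) (L : nat) : R := T / L%:R.

(* Index [k] of the cell [k h <= t < (k + 1) h]; for [h = T / L] it is [L] at
   [t = T]. *)
Definition nu (h t : R) : nat := Num.truncn (t / h).

(* [O(h)] as [h] goes to 0 along [h = T / L].  The values are extended reals so
   that an infinite supremum is not silently mapped to 0. *)
Definition bigO_step (T : R) (f : nat -> \bar R) : Prop :=
  exists c : R, \forall L \near \oo, (`| f L | <= (c * step T L)%:E)%E.

Definition sup_dist {d : nat} (T h : R) (P : R -> 'M[R]_d) (S : nat -> 'M[R]_d)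
    : \bar R :=
  ereal_sup [set (opnorm (P t - S (nu h t)))%:E | t in `[0, T]].

End StepSizes.

(* Main.v *)
(* One filter step maps the analysis covariance [a] to
   [a + h (A a + a A^T + Q - a G^T C^-1 G a) + O(h^2)], an Euler step of the
   Riccati equation, uniformly for [a] in a bounded set; the solution [P] makes
   the same step up to [O(h^2)] by the mean value theorem.  As the right-hand side
   is Lipschitz on bounded sets, the discrete Gronwall inequality gives an error
   [O(h)] as long as the analysis covariances stay bounded.  They do: while the
   error is at most 1 they are bounded by [sup |P| + 1], and for small [h] the
   Gronwall bound is itself at most 1, so the induction closes. *)
Require Import Defs.
From HB Require Import structures.
From mathcomp Require Import all_boot all_order all_algebra.
From mathcomp Require Import all_classical all_reals all_analysis.
From mathcomp Require Import ring lra.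
Import Order.TTheory GRing.Theory Num.Theory.
Import numFieldNormedType.Exports.
Local Open Scope classical_set_scope.
Local Open Scope ring_scope.

Set Implicit Arguments.
Unset Strict Implicit.

(** * The entrywise l1 norm and its comparison with the other norms *)

Section L1Norm.
Context {R : realType}.

(** The working norm of all estimates: it is submultiplicative, and it agrees with the operator norm
    up to a factor depending only on the dimensions, so [O(h)] bounds transfer both ways. *)
Definition l1norm {m n : nat} (A : 'M[R]_(m, n)) : R := \sum_i \sum_j `|A i j|.

Lemma l1norm_ge0 m n (A : 'M[R]_(m, n)) : 0 <= l1norm A.
Proof. by apply: sumr_ge0 => i _; apply: sumr_ge0. Qed.

Lemma l1norm0 m n : l1norm (0 : 'M[R]_(m, n)) = 0.
Proof. by rewrite /l1norm big1// => i _; rewrite big1// => j _; rewrite mxE normr0. Qed.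

Lemma ler_l1norm_entry m n (A : 'M[R]_(m, n)) i j : `|A i j| <= l1norm A.
Proof.
rewrite /l1norm (bigD1 i)//= (bigD1 j)//= -addrA lerDl addr_ge0 ?sumr_ge0//.
by move=> k _; apply: sumr_ge0.
Qed.

Lemma l1norm_le0 m n (A : 'M[R]_(m, n)) : l1norm A <= 0 -> A = 0.
Proof.
move=> A0; apply/matrixP => i j; rewrite mxE; apply/eqP.
by rewrite -normr_le0; apply: le_trans (ler_l1norm_entry _ _ _) A0.
Qed.

Lemma ler_l1normD m n (A B : 'M[R]_(m, n)) : l1norm (A + B) <= l1norm A + l1norm B.
Proof.
rewrite /l1norm -big_split/=; apply: ler_sum => i _.
by rewrite -big_split/=; apply: ler_sum => j _; rewrite mxE ler_normD.
Qed.

Lemma l1normZ m n a (A : 'M[R]_(m, n)) : l1norm (a *: A) = `|a| * l1norm A.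
Proof.
rewrite /l1norm mulr_sumr; apply: eq_bigr => i _.
by rewrite mulr_sumr; apply: eq_bigr => j _; rewrite mxE normrM.
Qed.

Lemma l1normN m n (A : 'M[R]_(m, n)) : l1norm (- A) = l1norm A.
Proof. by rewrite -scaleN1r l1normZ normrN1 mul1r. Qed.

Lemma ler_l1normM m n q (A : 'M[R]_(m, n)) (B : 'M[R]_(n, q)) :
  l1norm (A *m B) <= l1norm A * l1norm B.
Proof.
rewrite /l1norm mulr_suml; apply: ler_sum => i _.
apply: (@le_trans _ _ (\sum_k \sum_j `|A i j| * `|B j k|)).
  apply: ler_sum => k _; rewrite mxE.
  by apply: le_trans (ler_norm_sum _ _ _) _; apply: ler_sum => j _; rewrite normrM.
rewrite exchange_big/= mulr_suml; apply: ler_sum => j _.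
rewrite -mulr_sumr ler_wpM2l// (bigD1 j)//= lerDl.
by apply: sumr_ge0 => k _; apply: sumr_ge0.
Qed.

Lemma l1norm_le_entries m n (A : 'M[R]_(m, n)) (b : R) :
  (forall i j, `|A i j| <= b) -> l1norm A <= (m * n)%:R * b.
Proof.
move=> Ab; apply: (@le_trans _ _ (\sum_(i < m) \sum_(j < n) b)).
  by apply: ler_sum => i _; apply: ler_sum => j _.
by rewrite !sumr_const !card_ord -mulrnA mulnC mulr_natl.
Qed.

Lemma l1norm_le_frobenius m n (A : 'M[R]_(m, n)) :
  l1norm A <= (m * n)%:R * frobenius_norm A.
Proof.
apply: l1norm_le_entries => i j; rewrite -sqrtr_sqr /frobenius_norm ler_wsqrtr//.
rewrite (bigD1 i)//= (bigD1 j)//= -addrA lerDl addr_ge0//.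
  by apply: sumr_ge0 => k _; apply: sqr_ge0.
by apply: sumr_ge0 => k _; apply: sumr_ge0 => l _; apply: sqr_ge0.
Qed.

Lemma ler_euclid_entry n (x : 'cV[R]_n) i : `|x i 0| <= euclid_norm x.
Proof.
rewrite -sqrtr_sqr /euclid_norm ler_wsqrtr// (bigD1 i)//= lerDl.
by apply: sumr_ge0 => k _; apply: sqr_ge0.
Qed.

Lemma euclid_le_l1norm n (x : 'cV[R]_n) : euclid_norm x <= l1norm x.
Proof.
have -> : l1norm x = \sum_i `|x i 0|.
  by rewrite /l1norm; apply: eq_bigr => i _; rewrite big_ord1.
have S0 : 0 <= \sum_i `|x i 0| by apply: sumr_ge0.
rewrite /euclid_norm -(ger0_norm S0) -sqrtr_sqr ler_wsqrtr// expr2 mulr_suml.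
apply: ler_sum => i _; rewrite -real_normK ?num_real// expr2 ler_wpM2l//.
by rewrite (bigD1 i)//= lerDl sumr_ge0.
Qed.

Lemma euclid_mulmx_le m n (A : 'M[R]_(m, n)) (x : 'cV[R]_n) :
  euclid_norm x <= 1 -> euclid_norm (A *m x) <= l1norm A.
Proof.
move=> x1; apply: le_trans (euclid_le_l1norm _) _; rewrite /l1norm.
apply: ler_sum => i _; rewrite big_ord1 mxE.
apply: le_trans (ler_norm_sum _ _ _) _; apply: ler_sum => j _.
by rewrite normrM ler_piMr//; apply: le_trans (ler_euclid_entry _ _) x1.
Qed.

Lemma euclid0 n : euclid_norm (0 : 'cV[R]_n) = 0.
Proof.
by rewrite /euclid_norm big1 ?sqrtr0// => i _; rewrite mxE expr0n.
Qed.

(** The zero vector gives nonemptiness and [l1norm A] an upper bound, so the [sup] in [opnorm] can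
    be used through its universal property. *)
Lemma opnorm_has_sup m n (A : 'M[R]_(m, n)) :
  has_sup [set euclid_norm (A *m x) | x in [set x | euclid_norm x <= 1]].
Proof.
split; last by exists (l1norm A) => _ [x /= x1 <-]; apply: euclid_mulmx_le.
by exists 0, 0; rewrite /= ?mulmx0 euclid0.
Qed.

Lemma opnorm_le_l1norm m n (A : 'M[R]_(m, n)) : opnorm A <= l1norm A.
Proof.
apply: ge_sup; first by case: (opnorm_has_sup A).
by move=> _ [x /= x1 <-]; apply: euclid_mulmx_le.
Qed.

Lemma euclid_mulmx_le_opnorm m n (A : 'M[R]_(m, n)) (x : 'cV[R]_n) :
  euclid_norm x <= 1 -> euclid_norm (A *m x) <= opnorm A.
Proof.
by move=> x1; apply: ub_le_sup; [case: (opnorm_has_sup A)|exists x].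
Qed.

Lemma opnorm_ge0 m n (A : 'M[R]_(m, n)) : 0 <= opnorm A.
Proof.
by rewrite -(euclid0 m) -(mulmx0 _ A) euclid_mulmx_le_opnorm// euclid0.
Qed.

Lemma l1norm_le_opnorm m n (A : 'M[R]_(m, n)) :
  l1norm A <= (m * n)%:R * opnorm A.
Proof.
apply: l1norm_le_entries => i j.
(* A standard basis vector has norm at most 1 and picks out column [j], so each entry is a
   coordinate of an admissible image. *)
have e1 : euclid_norm (delta_mx j 0 : 'cV[R]_n) <= 1.
  rewrite /euclid_norm (bigD1 j)//= big1 => [|k kj].
    by rewrite mxE !eqxx addr0 expr1n sqrtr1.
  by rewrite mxE (negbTE kj) expr0n.
apply: le_trans _ (euclid_mulmx_le_opnorm A e1).
have -> : A i j = (A *m delta_mx j 0 : 'cV[R]_m) i 0 by rewrite -colE mxE.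
exact: ler_euclid_entry.
Qed.

End L1Norm.

(** * Inverses of small perturbations of an invertible matrix *)

Section PerturbedInverse.
Context {R : realType} {n : nat}.
Implicit Types C E : 'M[R]_n.

Lemma sym_posdef_unit C : sym_posdef C -> C \in unitmx.
Proof.
move=> [_ Cpos]; rewrite -row_free_unit -kermx_eq0; apply/eqP/row_matrixP => i.
rewrite row0; set u := row i _.
have uC : u *m C = 0 by apply/sub_kermxP; apply: row_sub.
apply/eqP/negPn/negP => u0; have := Cpos u^T.
by rewrite trmxK uC mul0mx mxE ltxx trmx_eq0 u0 => /(_ isT).
Qed.

(** A left kernel vector [u] of [C + E] satisfies [u = - u E C^-1], so its norm is at most half of
    itself and [u] vanishes. *)
Lemma unitmx_perturb C E :
  C \in unitmx -> l1norm (E *m invmx C) <= 2^-1 -> C + E \in unitmx.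
Proof.
move=> uC E2; rewrite -row_free_unit -kermx_eq0; apply/eqP/row_matrixP => i.
rewrite row0; set u := row i _.
have : u *m (C + E) = 0 by apply/sub_kermxP; apply: row_sub.
rewrite mulmxDr => /eqP; rewrite addr_eq0 => /eqP uCE.
have uE : u = - (u *m (E *m invmx C)).
  by rewrite mulmxA -mulNmx -uCE mulmxK.
apply: l1norm_le0; have : l1norm u <= l1norm u * 2^-1.
  rewrite {1}uE l1normN; apply: le_trans (ler_l1normM _ _) _.
  by rewrite ler_wpM2l// l1norm_ge0.
by lra.
Qed.

Lemma invmx_perturb C E :
  C \in unitmx -> C + E \in unitmx ->
  invmx (C + E) = invmx C - invmx (C + E) *m (E *m invmx C).
Proof.
move=> uC uCE; apply/eqP; rewrite -subr_eq opprK.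
have {1}-> : invmx (C + E) = invmx (C + E) *m (C *m invmx C).
  by rewrite mulmxV// mulmx1.
by rewrite -mulmxDr -mulmxDl mulmxA mulVmx// mul1mx.
Qed.

(** The resolvent identity bounds the norm of the perturbed inverse by that of [invmx C] plus half
    of itself; the half is absorbed on the left. *)
Lemma l1norm_invmx_perturb C E :
  C \in unitmx -> l1norm (E *m invmx C) <= 2^-1 ->
  l1norm (invmx (C + E)) <= 2 * l1norm (invmx C).
Proof.
move=> uC E2; have uCE := unitmx_perturb uC E2.
have := ler_l1normD (invmx C) (- (invmx (C + E) *m (E *m invmx C))).
rewrite -invmx_perturb// l1normN.
have := ler_l1normM (invmx (C + E)) (E *m invmx C).
have := ler_wpM2l (l1norm_ge0 (invmx (C + E))) E2.
by lra.
Qed.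

End PerturbedInverse.

(** Unlike [mxE], these three entry rules leave matrix products folded, so that [ring] treats the
    entries of a product as atoms. *)
Lemma addmx_entry (R : realType) m n (A B : 'M[R]_(m, n)) i j :
  (A + B) i j = A i j + B i j.
Proof. by rewrite mxE. Qed.

Lemma oppmx_entry (R : realType) m n (A : 'M[R]_(m, n)) i j : (- A) i j = - A i j.
Proof. by rewrite mxE. Qed.

Lemma scalemx_entry (R : realType) m n (a : R) (A : 'M[R]_(m, n)) i j :
  (a *: A) i j = a * A i j.
Proof. by rewrite mxE. Qed.

(** * Uniform boundedness of matrix families *)

Section BoundedFamilies.
Context {R : realType} {I : Type}.
Implicit Types (D : set I) (a : I -> R).

Definition l1bounded D {m n} (F : I -> 'M[R]_(m, n)) : Prop :=
  exists c, forall i, D i -> l1norm (F i) <= c.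

Lemma l1bounded_cst D m n (A : 'M[R]_(m, n)) : l1bounded D (fun=> A).
Proof. by exists (l1norm A). Qed.

Lemma l1boundedD D m n (F H : I -> 'M[R]_(m, n)) :
  l1bounded D F -> l1bounded D H -> l1bounded D (fun i => F i + H i).
Proof.
move=> [b Fb] [c Hc]; exists (b + c) => i Di.
by apply: le_trans (ler_l1normD _ _) _; rewrite lerD ?Fb ?Hc.
Qed.

Lemma l1boundedN D m n (F : I -> 'M[R]_(m, n)) :
  l1bounded D F -> l1bounded D (fun i => - F i).
Proof. by move=> [b Fb]; exists b => i Di; rewrite l1normN Fb. Qed.

Lemma l1boundedM D m n q (F : I -> 'M[R]_(m, n)) (H : I -> 'M[R]_(n, q)) :
  l1bounded D F -> l1bounded D H -> l1bounded D (fun i => F i *m H i).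
Proof.
move=> [b Fb] [c Hc]; exists (b * c) => i Di.
by apply: le_trans (ler_l1normM _ _) _; rewrite ler_pM ?l1norm_ge0 ?Fb ?Hc.
Qed.

Lemma l1boundedZ D m n a (F : I -> 'M[R]_(m, n)) (b : R) :
  (forall i, D i -> `|a i| <= b) -> l1bounded D F -> l1bounded D (fun i => a i *: F i).
Proof.
move=> ab [c Fc]; exists (b * c) => i Di.
by rewrite l1normZ ler_pM ?l1norm_ge0 ?ab ?Fc.
Qed.

End BoundedFamilies.

(** Boundedness is read off the syntax of an expression. Known bounds come first, so that named
    factors stay closed; scaling by a varying coefficient is left out, as it needs a bound on that
    coefficient. *)
Ltac l1bound := repeat first
  [ solve [auto 2] | apply: l1boundedD | apply: l1boundedN | apply: l1boundedM
  | apply: l1bounded_cst ].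

(** * One filter step as a perturbed Euler step of the Riccati equation *)

Section OneStep.
Context {R : realType} {d p : nat}.
Variables (A : 'M[R]_d) (G : 'M[R]_(p, d)) (Q : 'M[R]_d) (C : 'M[R]_p).

(** The forecast covariance is [a + h *: forecast_rate h a N], where [N] is the covariance of the
    scaled perturbations and [2^-1 *: Q] their correlation with the ensemble. *)
Definition forecast_rate (h : R) (a N : 'M[R]_d) : 'M[R]_d :=
  A *m a + a *m A^T + Q +
  h *: (A *m a *m A^T + A *m (2^-1 *: Q) + (2^-1 *: Q) *m A^T + N).

Definition analysis_map (h : R) (f : 'M[R]_d) : 'M[R]_d :=
  (1%:M - h *: (kalman_gain G C h f *m G)) *m f.

Lemma analysis_mapE h f : analysis_map h f =
  f - h *: (f *m G^T *m invmx (C + h *: (G *m f *m G^T)) *m G *m f).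
Proof. by rewrite /analysis_map mulmxBl mul1mx -scalemxAl. Qed.

(** The quadratic term is handled by [a H a - b H b = a H (a - b) + (a - b) H b], with one factor
    bounded by [B] in each summand. *)
Lemma riccati_rhs_lipschitz (B : R) : exists c, forall a b : 'M[R]_d,
  l1norm a <= B -> l1norm b <= B ->
  l1norm (riccati_rhs A G Q C a - riccati_rhs A G Q C b) <= c * l1norm (a - b).
Proof.
pose H := G^T *m invmx C *m G.
exists (l1norm A + l1norm A^T + 2 * (B * l1norm H)) => a b aB bB.
have -> : riccati_rhs A G Q C a - riccati_rhs A G Q C b =
    A *m (a - b) + (a - b) *m A^T - a *m H *m (a - b) - (a - b) *m H *m b.
  rewrite /riccati_rhs /H !(mulmxBl, mulmxBr, mulmxA).
  by apply/matrixP => i j; rewrite !(addmx_entry, oppmx_entry); ring.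
have B0 : 0 <= B by apply: le_trans aB; apply: l1norm_ge0.
have N0 := @l1norm_ge0 R.
rewrite mulrDl mulrDl [2 * _]mulr_natl mulr2n mulrDl !addrA.
do 3?[apply: le_trans (ler_l1normD _ _) (lerD _ _)]; rewrite ?l1normN.
- exact: ler_l1normM.
- by rewrite mulrC; exact: ler_l1normM.
- apply: le_trans (ler_l1normM _ _) _; apply: ler_wpM2r => //.
  by apply: le_trans (ler_l1normM _ _) _; apply: ler_wpM2r.
- have -> : B * l1norm H * l1norm (a - b) = l1norm (a - b) * l1norm H * B by ring.
  apply: le_trans (ler_l1normM _ _) _; apply: ler_pM => //.
  exact: ler_l1normM.
Qed.

(* An identity rather than an estimate: the remainder is bounded as soon as its
   factors are. *)
Lemma filter_step_remainder (h : R) (a N : 'M[R]_d) :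
  let Z := forecast_rate h a N in
  let f := a + h *: Z in
  let S := G *m f *m G^T in
  let V := invmx (C + h *: S) in
  let H := G^T *m invmx C *m G in
  C \in unitmx -> C + h *: S \in unitmx ->
  analysis_map h f - (a + h *: riccati_rhs A G Q C a) =
  h ^+ 2 *: (A *m a *m A^T + A *m (2^-1 *: Q) + (2^-1 *: Q) *m A^T + N
    - a *m H *m Z - Z *m H *m f
    + f *m G^T *m V *m (S *m invmx C) *m G *m f).
Proof.
move=> Z f S V H uC uCS; rewrite analysis_mapE -/S -/V.
(* By the resolvent identity, replacing the perturbed inverse by [invmx C] costs a factor [h]; the
   quadratic term already carries another one. *)
have VE : G^T *m V *m G = H - h *: (G^T *m V *m (S *m invmx C) *m G).
  rewrite {1}/V invmx_perturb// -/V mulmxBr mulmxBl -/H; congr (_ - _).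
  by rewrite -!(scalemxAl, scalemxAr) !mulmxA.
have -> : f *m G^T *m V *m G *m f = f *m H *m f -
    h *: (f *m G^T *m V *m (S *m invmx C) *m G *m f).
  have -> : f *m G^T *m V *m G *m f = f *m (G^T *m V *m G) *m f.
    by rewrite !mulmxA.
  by rewrite VE mulmxBr mulmxBl -scalemxAr -scalemxAl !mulmxA.
move: (f *m G^T *m V *m _ *m _ *m _) => W.
have -> : f *m H *m f = a *m H *m a + h *: (a *m H *m Z + Z *m H *m f).
  transitivity (a *m H *m (a + h *: Z) + (h *: Z) *m H *m f).
    by rewrite -!mulmxDl.
  by rewrite mulmxDr -scalemxAr -!scalemxAl scalerDr addrA.
have -> : a *m H *m a = a *m G^T *m invmx C *m G *m a by rewrite /H !mulmxA.
rewrite /riccati_rhs.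
set U1 := a *m H *m Z; set U2 := Z *m H *m f; set U3 := a *m G^T *m _ *m _ *m _.
rewrite /f /Z /forecast_rate.
apply/matrixP => i j.
by rewrite !(addmx_entry, oppmx_entry, scalemx_entry) /=; ring.
Qed.

(** Both differences are a power of [h] times an expression in bounded factors. The delicate factor
    is the inverse, whose uniform bound dictates [h0]. *)
Lemma filter_step_consistency (B kappa : R) : C \in unitmx ->
  exists h0 c : R, 0 < h0 /\ forall h a N, 0 <= h <= h0 ->
    l1norm a <= B -> l1norm N <= kappa ->
    let f := a + h *: forecast_rate h a N in
    l1norm (analysis_map h f - (a + h *: riccati_rhs A G Q C a)) <= c * h ^+ 2 /\
    l1norm (f - analysis_map h f) <= c * h.
Proof.
move=> uC.
pose I := (R * 'M[R]_d * 'M[R]_d)%type.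
pose D h0 : set I := [set i | [/\ 0 <= i.1.1 <= h0, l1norm i.1.2 <= B &
  l1norm i.2 <= kappa]].
pose Z (i : I) := forecast_rate i.1.1 i.1.2 i.2.
pose f i := i.1.2 + i.1.1 *: Z i.
pose S i := G *m f i *m G^T.
pose V (i : I) := invmx (C + i.1.1 *: S i).
have ha h0 : l1bounded (D h0) (fun i => i.1.2) by exists B => i [].
have hN h0 : l1bounded (D h0) (fun i => i.2) by exists kappa => i [].
have hh h0 i : D h0 i -> `|i.1.1| <= h0.
  by move=> [/andP[h00 hh0] _ _]; rewrite ger0_norm.
have hZ h0 : l1bounded (D h0) Z.
  by rewrite /Z /forecast_rate; l1bound; apply: (l1boundedZ (hh h0)); l1bound.
have hf h0 : l1bounded (D h0) f.
  by rewrite /f; l1bound; apply: (l1boundedZ (hh h0)); l1bound.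
have hS h0 : l1bounded (D h0) S by rewrite /S; l1bound.
(* The bound [s0] is taken over step sizes up to 1, before [h0] is known; this avoids a circular
   choice, since [h0] depends on it. *)
have [s0 hs0] : l1bounded (D 1) (fun i => S i *m invmx C) by l1bound.
pose s := Num.max s0 1.
have s1 : 1 <= s by rewrite le_max lexx orbT.
(* This makes [h * S * C^-1] at most one half in norm, as the perturbation lemmas require; [s >= 1]
   ensures [h0 <= 1]. *)
pose h0 : R := (2 * s)^-1.
have h0gt : 0 < h0 by rewrite invr_gt0; lra.
have h0s : h0 * s = 2^-1 by rewrite /h0; field; lra.
have h01 : h0 <= 1 by nra.
have small i : D h0 i -> l1norm (i.1.1 *: S i *m invmx C) <= 2^-1.
  move=> [/andP[hi0 hih0] iB iK]; rewrite -scalemxAl l1normZ ger0_norm//.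
  rewrite -h0s ler_pM ?l1norm_ge0// /s le_max hs0//.
  by split=> //; rewrite hi0 (le_trans hih0 h01).
have hV : l1bounded (D h0) V.
  by exists (2 * l1norm (invmx C)) => i /small; apply: l1norm_invmx_perturb.
have [c1 hc1] : l1bounded (D h0) (fun i =>
    A *m i.1.2 *m A^T + A *m (2^-1 *: Q) + (2^-1 *: Q) *m A^T + i.2
    - i.1.2 *m (G^T *m invmx C *m G) *m Z i - Z i *m (G^T *m invmx C *m G) *m f i
    + f i *m G^T *m V i *m (S i *m invmx C) *m G *m f i).
  have := ha h0; have := hN h0; have := hZ h0; have := hf h0; have := hS h0.
  by move=> *; l1bound.
have [c2 hc2] : l1bounded (D h0) (fun i => f i *m G^T *m V i *m G *m f i).
  by have := hf h0 => ?; l1bound.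
exists h0, (Num.max c1 c2); split=> // h a N hh0 aB Nk; split.
  have Di : D h0 (h, a, N) by [].
  rewrite filter_step_remainder//; last exact: unitmx_perturb uC (small _ Di).
  rewrite l1normZ ger0_norm ?sqr_ge0// mulrC ler_wpM2r ?sqr_ge0//.
  by rewrite le_max (hc1 _ Di).
have Di : D h0 (h, a, N) by [].
rewrite analysis_mapE opprB addrCA subrr addr0 l1normZ ger0_norm; last by case/andP: hh0.
rewrite mulrC ler_wpM2r//; first by case/andP: hh0.
by rewrite le_max (hc2 _ Di) orbT.
Qed.

End OneStep.

(** * The covariance of the forecast ensemble *)

Section EnsembleCovariance.
Context {R : realType} {M d : nat}.

Definition ens_avg {m n} (F : 'I_M -> 'M[R]_(m, n)) : 'M[R]_(m, n) :=
  (M%:R - 1)^-1 *: \sum_i F i.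

Lemma ens_avgD m n (F H : 'I_M -> 'M[R]_(m, n)) :
  ens_avg (fun i => F i + H i) = ens_avg F + ens_avg H.
Proof. by rewrite /ens_avg big_split/= scalerDr. Qed.

Lemma ens_avgZ m n a (F : 'I_M -> 'M[R]_(m, n)) :
  ens_avg (fun i => a *: F i) = a *: ens_avg F.
Proof. by rewrite /ens_avg -scaler_sumr !scalerA mulrC. Qed.

Lemma ens_avgMl m n q (B : 'M[R]_(m, n)) (F : 'I_M -> 'M[R]_(n, q)) :
  ens_avg (fun i => B *m F i) = B *m ens_avg F.
Proof. by rewrite /ens_avg -mulmx_sumr scalemxAr. Qed.

Lemma ens_avgMr m n q (F : 'I_M -> 'M[R]_(m, n)) (B : 'M[R]_(n, q)) :
  ens_avg (fun i => F i *m B) = ens_avg F *m B.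
Proof. by rewrite /ens_avg -mulmx_suml scalemxAl. Qed.

Lemma ens_avg_tr m n (F : 'I_M -> 'M[R]_(m, n)) :
  ens_avg (fun i => (F i)^T) = (ens_avg F)^T.
Proof. by rewrite /ens_avg [RHS]linearZ/=; congr (_ *: _); rewrite raddf_sum. Qed.

Lemma eq_ens_avg m n (F H : 'I_M -> 'M[R]_(m, n)) : F =1 H -> ens_avg F = ens_avg H.
Proof. by move=> FH; rewrite /ens_avg (eq_bigr _ (fun i _ => FH i)). Qed.

(** The forecast deviations are [u + h (A u + S v)], with [u] and [v] the deviations of the ensemble
    and of the perturbations. Expanding the product leaves only averages that are the old
    covariance, the prescribed cross term or its transpose, or the perturbation covariance. *)
Lemma ens_cov_forecast (A Q S : 'M[R]_d) (h : R) (X W Y : 'I_M -> 'cV[R]_d) :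
  let x := ens_mean X in let w := ens_mean W in
  S^T = S -> Q^T = Q ->
  (forall i, Y i = X i + h *: (A *m X i) + h *: (S *m W i)) ->
  ens_avg (fun i => (X i - x) *m (W i - w)^T *m S) = 2^-1 *: Q ->
  ens_cov Y = ens_cov X + h *: forecast_rate A Q h (ens_cov X)
    (ens_avg (fun i => S *m (W i - w) *m (W i - w)^T *m S)).
Proof.
move=> x w ST QT YE cross.
pose u i := X i - x; pose v i := W i - w.
have meanY : ens_mean Y = x + h *: (A *m x) + h *: (S *m w).
  rewrite /x /w /ens_mean (eq_bigr _ (fun i _ => YE i)) !big_split/= !scalerDr.
  rewrite -!scaler_sumr -!mulmx_sumr -!scalemxAr !scalerA.
  by rewrite [h * _]mulrC.
have Yu i : Y i - ens_mean Y = u i + h *: (A *m u i + S *m v i).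
  rewrite meanY YE /u /v !mulmxBr.
  by apply/matrixP => j k; rewrite !(addmx_entry, oppmx_entry, scalemx_entry); ring.
have prod i : (Y i - ens_mean Y) *m (Y i - ens_mean Y)^T =
    u i *m (u i)^T + h *: (A *m (u i *m (u i)^T) + u i *m (u i)^T *m A^T
    + (u i *m (v i)^T *m S + (u i *m (v i)^T *m S)^T)
    + h *: (A *m (u i *m (u i)^T) *m A^T + A *m (u i *m (v i)^T *m S)
            + (u i *m (v i)^T *m S)^T *m A^T
            + S *m v i *m (v i)^T *m S)).
  rewrite Yu; move: (u i) (v i) => a b.
  have -> : (a + h *: (A *m a + S *m b))^T = a^T + h *: (a^T *m A^T + b^T *m S).
    by rewrite linearD linearZ/= linearD/= !trmx_mul ST.
  have -> : (a *m b^T *m S)^T = S *m b *m a^T.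
    by rewrite !trmx_mul trmxK ST mulmxA.
  rewrite !(mulmxDl, mulmxDr) -!scalemxAl -!scalemxAr !(mulmxDl, mulmxDr) !mulmxA.
  by apply/matrixP => j k; rewrite !(addmx_entry, oppmx_entry, scalemx_entry); ring.
have crossT : ens_avg (fun i => (u i *m (v i)^T *m S)^T) = 2^-1 *: Q.
  by rewrite ens_avg_tr cross linearZ/= QT.
have -> : ens_cov Y = ens_avg (fun i => (Y i - ens_mean Y) *m (Y i - ens_mean Y)^T).
  by [].
rewrite (eq_ens_avg prod) ens_avgD ens_avgZ !ens_avgD ens_avgZ !ens_avgD.
rewrite !ens_avgMr !ens_avgMl !ens_avgMr crossT.
rewrite (_ : ens_avg (fun i => u i *m (v i)^T) *m S = 2^-1 *: Q); last first.
  by rewrite -ens_avgMr cross.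
rewrite (_ : ens_avg (fun i => u i *m (u i)^T) = ens_cov X)//.
rewrite /forecast_rate; congr (_ + h *: (_ + _)); congr (_ + _).
(* The cross term and its transpose contribute half of [Q] each, which produces the full noise term
   of the Riccati equation. *)
by rewrite -scalerDl (_ : 2^-1 + 2^-1 = 1 :> R) ?scale1r//; field.
Qed.

End EnsembleCovariance.

(** * Mean value estimates for matrix-valued functions *)

Section MeanValue.
Context {R : realType}.

(** The scalar mean value theorem is applied to each entry with its own intermediate point, whence
    the factor [m * n]. The free slope [D] serves twice: zero gives a Lipschitz bound, the initial
    derivative a second-order Taylor bound. *)
Lemma mx_mean_value m n (F dF : R -> 'M[R]_(m, n)) (s t b : R) (D : 'M[R]_(m, n)) :
  s <= t -> {within `[s, t], continuous F} ->
  (forall x : R, x \in `]s, t[ -> is_derive x 1 F (dF x)) ->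
  (forall x, x \in `]s, t[ -> l1norm (dF x - D) <= b) ->
  l1norm (F t - F s - (t - s) *: D) <= (m * n)%:R * (b * (t - s)).
Proof.
rewrite le_eqVlt => /predU1P[<- _ _ _|st cF dFE dFb].
  by rewrite !subrr scale0r subr0 l1norm0 !mulr0.
apply: l1norm_le_entries => i j.
have cij : {within `[s, t], continuous (fun x => F x i j)}.
  apply: (within_continuous_comp _ _ (fun B : 'M[R]_(m, n) => B i j)) => // B _.
  exact: coord_continuous.
have dij x : x \in `]s, t[ -> is_derive x 1 (fun y => F y i j) (dF x i j).
  move=> /dFE [Fx dFx]; split; first by move/derivable_mxP: Fx.
  by rewrite -dFx derive_mx// mxE.
have [c cst Fc] := MVT st dij cij.
rewrite !(addmx_entry, oppmx_entry, scalemx_entry) Fc.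
have -> : dF c i j * (t - s) - (t - s) * D i j = (dF c - D) i j * (t - s).
  by rewrite !(addmx_entry, oppmx_entry); ring.
rewrite normrM [`|t - s|]gtr0_norm ?subr_gt0// ler_pM2r ?subr_gt0//.
exact: le_trans (ler_l1norm_entry _ _ _) (dFb _ cst).
Qed.

Lemma mx_mean_value_bound m n (F dF : R -> 'M[R]_(m, n)) (s t b : R) :
  s <= t -> {within `[s, t], continuous F} ->
  (forall x : R, x \in `]s, t[ -> is_derive x 1 F (dF x)) ->
  (forall x, x \in `]s, t[ -> l1norm (dF x) <= b) ->
  l1norm (F t - F s) <= (m * n)%:R * (b * (t - s)).
Proof.
move=> st cF dFE dFb; have -> : F t - F s = F t - F s - (t - s) *: 0.
  by rewrite scaler0 oppr0 addr0.
apply: (mx_mean_value st cF dFE) => x /dFb.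
by rewrite -{1}[dF x]addr0 -{1}oppr0.
Qed.

Lemma mx_continuous_bounded m n (F : R -> 'M[R]_(m, n)) (s t : R) :
  {within `[s, t], continuous F} ->
  exists b, forall x, x \in `[s, t] -> l1norm (F x) <= b.
Proof.
move=> cF; have /compact_bounded[N [_ FN]] :=
  continuous_compact cF (@segment_compact _ s t).
exists ((m * n)%:R * (N + 1)) => x xst; apply: l1norm_le_entries => i j.
have : `|F x| <= N + 1 by apply: FN; [rewrite ltrDl|exists x].
rewrite {1}/Num.Def.normr/= mx_normrE => FN1; apply: le_trans FN1.
by rewrite (le_bigmax_cond _ (fun ij => `|F x ij.1 ij.2|) (j := (i, j))).
Qed.

End MeanValue.

(** * Regularity of the Riccati solution *)

Section Riccati.
Context {R : realType} {d p : nat}.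
Variables (A : 'M[R]_d) (G : 'M[R]_(p, d)) (Q : 'M[R]_d) (C : 'M[R]_p).
Variables (T : R) (P : R -> 'M[R]_d).

(** A bootstrap: compactness bounds [P], hence its derivative, so [P] is Lipschitz; then the
    derivative is Lipschitz along [P], which gives the Taylor estimate. *)
Lemma riccati_solution_regular : riccati_solution A G Q C T P -> exists B c : R,
  [/\ forall t, t \in `[0, T] -> l1norm (P t) <= B,
      forall s t, 0 <= s -> s <= t -> t <= T ->
        l1norm (P t - P s) <= c * (t - s)
    & forall s t, 0 <= s -> s <= t -> t <= T ->
        l1norm (P t - (P s + (t - s) *: riccati_rhs A G Q C (P s))) <=
        c * (t - s) ^+ 2].
Proof.
move=> [_ cP dP].
have [B PB] := mx_continuous_bounded cP.
have [b rb] : l1bounded [set a : 'M[R]_d | l1norm a <= B] (riccati_rhs A G Q C).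
  have : l1bounded [set a : 'M[R]_d | l1norm a <= B] id by exists B.
  by move=> ?; rewrite /riccati_rhs; l1bound.
have [c0 c0P] := riccati_rhs_lipschitz A G Q C B.
pose c := Num.max c0 0; pose D := (d * d)%:R * b.
have dPst (s t : R) : 0 <= s -> t <= T -> forall x, x \in `]s, t[ ->
    is_derive x 1 P (riccati_rhs A G Q C (P x)).
  move=> s0 tT x; rewrite in_itv/= => /andP[sx xt]; apply: dP.
  by rewrite in_itv/= (le_lt_trans s0 sx) (lt_le_trans xt tT).
have cst (s t : R) : 0 <= s -> t <= T -> {within `[s, t], continuous P}.
  move=> s0 tT; apply: continuous_subspaceW cP => x /=.
  by rewrite !in_itv/= => /andP[sx xt]; rewrite (le_trans s0 sx) (le_trans xt tT).
have subT (s t x : R) : 0 <= s -> t <= T -> x \in `[s, t] -> x \in `[0, T].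
  move=> s0 tT; rewrite !in_itv/= => /andP[sx xt].
  by rewrite (le_trans s0 sx) (le_trans xt tT).
have lipP s t : 0 <= s -> s <= t -> t <= T -> l1norm (P t - P s) <= D * (t - s).
  move=> s0 st tT; rewrite /D -mulrA.
  apply: (mx_mean_value_bound st (cst _ _ s0 tT) (dPst _ _ s0 tT)) => x xst.
  by apply/rb/PB/(subT _ _ _ s0 tT)/subset_itv_oo_cc.
exists B, (Num.max D ((d * d)%:R * (c * D))); split=> // s t s0 st tT.
  apply: le_trans (lipP _ _ s0 st tT) _.
  by rewrite ler_wpM2r ?subr_ge0// le_max lexx.
apply: (@le_trans _ _ ((d * d)%:R * (c * D) * (t - s) ^+ 2)); last first.
  by rewrite ler_wpM2r ?sqr_ge0// le_max lexx orbT.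
have -> : (d * d)%:R * (c * D) * (t - s) ^+ 2 =
  (d * d)%:R * ((c * (D * (t - s))) * (t - s)) by ring.
rewrite opprD addrA.
apply: (mx_mean_value st (cst _ _ s0 tT) (dPst _ _ s0 tT)) => x xst.
have xst' := subset_itv_oo_cc xst.
have [sx xt] : s <= x /\ x <= t by move: xst'; rewrite in_itv/= => /andP[].
apply: le_trans (c0P _ _ (PB _ _) (PB _ _)) _.
- exact: subT xst'.
- by rewrite in_itv/= s0 (le_trans st tT).
apply: (@le_trans _ _ (c * l1norm (P x - P s))).
  by rewrite ler_wpM2r ?l1norm_ge0// le_max lexx.
rewrite ler_wpM2l ?le_max ?lexx ?orbT//.
apply: le_trans (lipP _ _ s0 sx (le_trans xt tT)) _.
have := lipP _ _ s0 st tT; have := l1norm_ge0 (P t - P s).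
(* A negative [D] is impossible here, as the Lipschitz bound on an interval of positive length would
   make a norm negative. *)
have [D0 _ _|D0] := leP 0 D; first by rewrite ler_wpM2l// lerD2r.
have tsgt : 0 < t - s.
  by rewrite subr_gt0; move: xst; rewrite in_itv/= => /andP[]; apply: lt_trans.
by nra.
Qed.

End Riccati.

(* The one-step bound is only assumed while the error is at most 1: smallness
   of the final bound propagates it. *)
Lemma discrete_gronwall {R : realType} (e : nat -> R) (L : nat) (c0 l c h : R) :
  0 <= c0 -> 0 <= l -> 0 <= c -> 0 <= h -> e 0%N <= c0 ->
  (forall k, (k < L)%N -> e k <= 1 -> e k.+1 <= (1 + h * l) * e k + c * h ^+ 2) ->
  let b := expR (L%:R * (h * l)) * (c0 + L%:R * (c * h ^+ 2)) in
  b <= 1 -> forall k, (k <= L)%N -> e k <= b.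
Proof.
move=> c00 l0 cge h0 e0 estep b b1.
have hl : 0 <= h * l by rewrite mulr_ge0.
have ch : 0 <= c * h ^+ 2 by rewrite mulr_ge0 ?sqr_ge0.
(* [E] is an explicit majorant of the recursion; [1 + x <= expR x] puts it below [b], so the
   induction also keeps [e k <= 1]. *)
pose E k := (1 + h * l) ^+ k * (c0 + k%:R * (c * h ^+ 2)).
have Eb k : (k <= L)%N -> E k <= b.
  move=> kL; rewrite /E /b ler_pM//.
  - by rewrite exprn_ge0// addr_ge0.
  - by rewrite addr_ge0// mulr_ge0.
  - rewrite expRM_natl; apply: le_trans (_ : (1 + h * l) ^+ L <= _).
      by rewrite ler_weXn2l// lerDl.
    by rewrite lerXn2r ?nnegrE ?addr_ge0 ?expR_ge0 ?expR_ge1Dx.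
  - by rewrite lerD2l ler_wpM2r// ler_nat.
suff eE k : (k <= L)%N -> e k <= E k by move=> k kL; exact: le_trans (eE _ kL) (Eb _ kL).
elim: k => [_|k IH kL]; first by rewrite /E expr0 mul1r mul0r addr0.
have ekE := IH (ltnW kL).
apply: le_trans (estep _ kL (le_trans ekE (le_trans (Eb _ (ltnW kL)) b1))) _.
have g1 : 1 <= (1 + h * l) ^+ k.+1 by rewrite exprn_ege1// lerDl.
have -> : E k.+1 = (1 + h * l) * E k + (1 + h * l) ^+ k.+1 * (c * h ^+ 2).
  by rewrite /E exprS -[k.+1]addn1 natrD; ring.
by rewrite lerD// ?ler_wpM2l ?addr_ge0// ler_peMl.
Qed.

(** * The time grid and suprema over the time interval *)

Section TimeGrid.
Context {R : realType}.
Implicit Type T : R.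

Lemma step_gt0 T L : 0 < T -> (0 < L)%N -> 0 < step T L.
Proof. by move=> T0 L0; rewrite divr_gt0// ltr0n. Qed.

Lemma mul_step T L : (0 < L)%N -> L%:R * step T L = T.
Proof. by move=> L0; rewrite /step mulrC divfK// pnatr_eq0 -lt0n. Qed.

Lemma near_step_le T (b : R) : 0 < T -> 0 < b -> \forall L \near \oo, step T L <= b.
Proof.
move=> T0 b0; exists (Num.trunc (T / b)).+1 => // L /= LT.
have L0 : (0 < L)%N by apply: leq_trans LT.
rewrite /step ler_pdivrMr ?ltr0n// mulrC -ler_pdivrMr//.
apply: le_trans (_ : (Num.trunc (T / b)).+1%:R <= _); last by rewrite ler_nat.
by have /andP[_ /ltW] := truncn_itv (ltW (divr_gt0 T0 b0)).
Qed.

Lemma nu_grid T L t : 0 < T -> (0 < L)%N -> 0 <= t -> t <= T ->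
  let s := (nu (step T L) t)%:R * step T L in
  [/\ (nu (step T L) t <= L)%N, 0 <= s, s <= t & t - s <= step T L].
Proof.
move=> T0 L0 t0 tT s; have h0 := step_gt0 T0 L0.
have /andP[lo up] := truncn_itv (divr_ge0 t0 (ltW h0)).
have st : s <= t by rewrite /s -ler_pdivlMr.
split=> //.
- by rewrite -(ler_nat R) -(ler_pM2r h0) mul_step// (le_trans st tT).
- by rewrite mulr_ge0// ltW.
- rewrite lerBlDr /s; apply: ltW; move: up; rewrite ltr_pdivrMr// -natr1 mulrDl mul1r.
  by rewrite addrC.
Qed.

Lemma sup_dist_le T d (h b : R) (P : R -> 'M[R]_d) (S : nat -> 'M[R]_d) :
  0 < T -> (forall t, 0 <= t -> t <= T -> l1norm (P t - S (nu h t)) <= b) ->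
  (`| sup_dist T h P S | <= b%:E)%E.
Proof.
move=> T0 Pb; rewrite gee0_abs.
  apply: ge_ereal_sup => _ [t /= tin <-]; move: tin; rewrite in_itv/= => /andP[t0 tT].
  by rewrite lee_fin; apply: le_trans (opnorm_le_l1norm _) (Pb _ t0 tT).
(* The supremum dominates its nonnegative value at time 0, which justifies dropping the absolute
   value. *)
apply: le_trans (_ : (opnorm (P 0 - S (nu h 0)))%:E <= _)%E.
  by rewrite lee_fin opnorm_ge0.
by apply: ereal_sup_ubound; exists 0 => //=; rewrite in_itv/= lexx ltW.
Qed.

End TimeGrid.

(** * The error on the grid and the convergence theorem *)

Section ErrorBound.
Context {R : realType} {d p M : nat}.

(** Reduces the ensemble filter to a recursion on covariance matrices; the witness [N] is the
    perturbation covariance, bounded through its Frobenius norm. *)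
Lemma filter_step_recursion (A : 'M[R]_d) (G : 'M[R]_(p, d)) (Q Qhalf : 'M[R]_d)
    (C : 'M[R]_p) (h kappa : R) (L : nat)
    (Xa Xf W : nat -> 'I_M -> 'cV[R]_d) (dY : nat -> 'cV[R]_p) (k : nat) :
  Qhalf^T = Qhalf -> Q^T = Q ->
  ensemble_srf A G Qhalf C h L Xa Xf W dY ->
  perturbation_assumption Q Qhalf kappa L Xa W -> (k < L)%N ->
  let a := analysis_cov Xa in
  exists N : 'M[R]_d, [/\ l1norm N <= (d * d)%:R * kappa,
    forecast_cov Xa Xf k.+1 = a k + h *: forecast_rate A Q h (a k) N &
    a k.+1 = analysis_map G C h (forecast_cov Xa Xf k.+1)].
Proof.
move=> QhT QT filt pert kL a.
have [forec anal _] := filt k.+1 kL; have [cross sm _] := pert k.+1 kL.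
exists (ens_avg (fun i => Qhalf *m (W k.+1 i - ens_mean (W k.+1)) *m
  (W k.+1 i - ens_mean (W k.+1))^T *m Qhalf)); split.
- by apply: le_trans (l1norm_le_frobenius _) _; rewrite ler_wpM2l.
- exact: ens_cov_forecast QhT QT forec cross.
- exact: anal.
Qed.

(** The constants precede [L], hence are uniform in the step size. The initial error is assumed for
    each [L] separately, because the [O(h)] hypothesis provides it only for large [L]. *)
Lemma filter_grid_error (T : R) (A : 'M[R]_d) (G : 'M[R]_(p, d))
    (Q Qhalf : 'M[R]_d) (C : 'M[R]_p)
    (Xa Xf W : nat -> nat -> 'I_M -> 'cV[R]_d) (dY : nat -> nat -> 'cV[R]_p)
    (P : R -> 'M[R]_d) (kappa c0 : R) :
  0 < T -> Qhalf^T = Qhalf -> Q^T = Q -> C \in unitmx ->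
  (forall L : nat, (1 <= L)%N ->
     ensemble_srf A G Qhalf C (step T L) L (Xa L) (Xf L) (W L) (dY L)) ->
  (forall L : nat, (1 <= L)%N ->
     perturbation_assumption Q Qhalf kappa L (Xa L) (W L)) ->
  riccati_solution A G Q C T P -> 0 <= c0 ->
  exists h0 c : R, 0 < h0 /\ forall L : nat, (1 <= L)%N -> step T L <= h0 ->
    l1norm (P 0 - analysis_cov (Xa L) 0) <= c0 * step T L ->
    forall k : nat, (k <= L)%N ->
      l1norm (P (k%:R * step T L) - analysis_cov (Xa L) k) <= c * step T L /\
      l1norm (P (k%:R * step T L) - forecast_cov (Xa L) (Xf L) k) <= c * step T L.
Proof.
move=> T0 QhT QT uC filt pert ricc c00.
have [B [cP [PB _ Ptaylor]]] := riccati_solution_regular ricc.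
(* Constants are taken on the ball of radius [B + 1], which contains the analysis covariances while
   the error is at most 1. *)
have [l0 lip] := riccati_rhs_lipschitz A G Q C (B + 1).
have [h1 [c1 [h1gt consist]]] :=
  filter_step_consistency A G Q (B + 1) ((d * d)%:R * kappa) uC.
(* The existential constants carry no sign, so they are truncated at 0. [K] is the Gronwall bound
   divided by [h], using [L h = T]. *)
pose l := Num.max l0 0; pose c := Num.max (cP + c1) 0; pose c1' := Num.max c1 0.
pose K := expR (T * l) * (c0 + T * c).
have l_ge0 : 0 <= l by rewrite le_max lexx orbT.
have c_ge0 : 0 <= c by rewrite le_max lexx orbT.
have K_ge0 : 0 <= K by rewrite mulr_ge0 ?expR_ge0// addr_ge0// mulr_ge0// ltW.
have c1'_ge0 : 0 <= c1' by rewrite le_max lexx orbT.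
(* The second bound forces [K h <= 1], which closes the Gronwall induction; [K + 1] is invertible
   even if [K = 0]. *)
exists (Num.min h1 (K + 1)^-1), (K + c1'); split.
  by rewrite lt_min h1gt invr_gt0 ltr_wpDl.
move=> L L1; set h := step T L; rewrite le_min => /andP[hh1 hK] init k.
have h_gt0 : 0 < h by exact: step_gt0.
have hL : L%:R * h = T by exact: mul_step.
pose a := analysis_cov (Xa L).
pose e k := l1norm (P (k%:R * h) - a k).
have inT j : (j <= L)%N -> 0 <= j%:R * h /\ j%:R * h <= T.
  move=> jL; split; first by rewrite mulr_ge0// ltW.
  by rewrite -hL ler_wpM2r ?(ltW h_gt0)// ler_nat.
have aB j : (j <= L)%N -> e j <= 1 -> l1norm (a j) <= B + 1.
  move=> /inT[j0 jT] ej; have -> : a j = P (j%:R * h) - (P (j%:R * h) - a j).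
    by rewrite opprB addrC subrK.
  apply: le_trans (ler_l1normD _ _) _; rewrite l1normN lerD// PB//.
  by rewrite in_itv/= j0 jT.
have eb : expR (L%:R * (h * l)) * (c0 * h + L%:R * (c * h ^+ 2)) = K * h.
  by rewrite /K -hL (_ : L%:R * (h * l) = L%:R * h * l); [ring|ring].
have hh : 0 <= h <= h1 by rewrite (ltW h_gt0).
have estep j : (j < L)%N -> e j <= 1 -> e j.+1 <= (1 + h * l) * e j + c * h ^+ 2.
  move=> jL ej; have ajB := aB _ (ltnW jL) ej.
  have [N [Nk fE aE]] := filter_step_recursion QhT QT (filt _ L1) (pert _ L1) jL.
  have [s1 _] := consist h (a j) N hh ajB Nk.
  have [j0 jT] := inT _ (ltnW jL); have [_ j1T] := inT _ jL.
  have jh : j.+1%:R * h - j%:R * h = h by rewrite -mulrBl -natrB// subSnn mul1r.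
  have jj1 : j%:R * h <= j.+1%:R * h by rewrite -subr_ge0 jh ltW.
  have := Ptaylor _ _ j0 jj1 j1T; rewrite jh => s2.
  have PjB : l1norm (P (j%:R * h)) <= B + 1.
    by rewrite (le_trans (PB _ _)) ?lerDl// in_itv/= j0 jT.
  have s3 := lip _ _ PjB ajB.
  (* The new error splits into the Taylor remainder of [P], the consistency error of the filter, the
     old error, and the Lipschitz difference of the right-hand sides. *)
  rewrite /e; have -> : P (j.+1%:R * h) - a j.+1 =
      (P (j.+1%:R * h) - (P (j%:R * h) + h *: riccati_rhs A G Q C (P (j%:R * h))))
      - (a j.+1 - (a j + h *: riccati_rhs A G Q C (a j)))
      + (P (j%:R * h) - a j)
      + h *: (riccati_rhs A G Q C (P (j%:R * h)) - riccati_rhs A G Q C (a j)).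
    apply/matrixP => i i'.
    by rewrite !(addmx_entry, oppmx_entry, scalemx_entry); ring.
  do 3![apply: le_trans (ler_l1normD _ _) _; rewrite -?lerBrDr].
  rewrite l1normN l1normZ (gtr0_norm h_gt0) -/(e j).
  rewrite -fE -aE in s1.
  have s4 : l0 * e j <= l * e j by rewrite ler_wpM2r ?l1norm_ge0// le_max lexx.
  have s5 : (cP + c1) * h ^+ 2 <= c * h ^+ 2.
    by rewrite ler_wpM2r ?sqr_ge0// le_max lexx.
  have s6 := ler_wpM2l (ltW h_gt0) (le_trans s3 s4).
  by rewrite -/a in s1 s2 s6 *; move: s1 s2 s5 s6; rewrite mulrDl mulrA; lra.
have Kh1 : K * h <= 1.
  apply: le_trans (_ : (K + 1) * h <= _); first by rewrite ler_wpM2r ?(ltW h_gt0)// lerDl.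
  by rewrite mulrC -ler_pdivlMr ?div1r// ltr_wpDl.
have eK j : (j <= L)%N -> e j <= K * h.
  have e0 : e 0%N <= c0 * h by rewrite /e mul0r.
  move=> jL; rewrite -eb; apply: discrete_gronwall jL => //.
  - by rewrite mulr_ge0// ltW.
  - exact: ltW.
  - by rewrite eb.
have aerr j : (j <= L)%N -> e j <= (K + c1') * h.
  by move=> /eK ej; rewrite mulrDl (le_trans ej)// lerDl mulr_ge0// ltW.
move=> kL; split; first exact: aerr.
(* At index 0 the forecast covariance is by convention the analysis one; later it lies within
   [c1' * h] of the analysis covariance at the same index. *)
case: k kL => [|k] kL; first exact: aerr.
have ekB := aB _ (ltnW kL) (le_trans (eK _ (ltnW kL)) Kh1).
have [N [Nk fE aE]] := filter_step_recursion QhT QT (filt _ L1) (pert _ L1) kL.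
have [_ s1] := consist h (a k) N hh ekB Nk.
rewrite -fE -aE in s1.
have -> : P (k.+1%:R * h) - forecast_cov (Xa L) (Xf L) k.+1 =
    (P (k.+1%:R * h) - a k.+1) - (forecast_cov (Xa L) (Xf L) k.+1 - a k.+1).
  by rewrite opprB addrA subrK.
apply: le_trans (ler_l1normD _ _) _; rewrite l1normN mulrDl lerD//; first exact: eK.
by apply: le_trans s1 _; rewrite ler_wpM2r ?(ltW h_gt0)// le_max lexx.
Qed.

End ErrorBound.

Unset Implicit Arguments.
Set Strict Implicit.

Theorem theorem3p1 (R : realType) (T : R) (d p M : nat)
    (A : 'M[R]_d) (G : 'M[R]_(p, d)) (Q Qhalf : 'M[R]_d) (C : 'M[R]_p)
    (Xa Xf W : nat -> nat -> 'I_M -> 'cV[R]_d) (dY : nat -> nat -> 'cV[R]_p)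
    (P : R -> 'M[R]_d) :
  0 < T -> (1 <= d)%N -> (1 <= p)%N -> (2 <= M)%N ->
  sym_posdef Q -> sym_posdef C -> is_sqrtmx Q Qhalf ->
  (forall L : nat, (1 <= L)%N ->
     ensemble_srf A G Qhalf C (step T L) L (Xa L) (Xf L) (W L) (dY L)) ->
  (exists kappa : R, forall L : nat, (1 <= L)%N ->
     perturbation_assumption Q Qhalf kappa L (Xa L) (W L)) ->
  riccati_solution A G Q C T P ->
  bigO_step T (fun L => (opnorm (P 0 - analysis_cov (Xa L) 0))%:E) ->
  bigO_step T (fun L => sup_dist T (step T L) P (forecast_cov (Xa L) (Xf L))) /\
  bigO_step T (fun L => sup_dist T (step T L) P (analysis_cov (Xa L))).
Proof.
move=> T0 _ _ _ [QT _] /sym_posdef_unit uC [[QhT _] _] filt [kappa pert] ricc [c0 init].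
(* The factor [d * d] turns the initial operator-norm bound into an l1 bound. *)
pose c0' := (d * d)%:R * Num.max c0 0.
have c0'_ge0 : 0 <= c0' by rewrite mulr_ge0// le_max lexx orbT.
have [h0 [c [h0_gt0 err]]] := filter_grid_error T0 QhT QT uC filt pert ricc c0'_ge0.
have [_ [cP [_ Plip _]]] := riccati_solution_regular ricc.
pose cP' := Num.max cP 0.
(* Between grid points [P] moves by at most its Lipschitz constant times one step, while the
   discrete covariance stays frozen at index [nu]. *)
have grid (S : nat -> nat -> 'M[R]_d) L : (0 < L)%N ->
    (forall k, (k <= L)%N -> l1norm (P (k%:R * step T L) - S L k) <= c * step T L) ->
    (`| sup_dist T (step T L) P (S L) | <= ((cP' + c) * step T L)%:E)%E.
  move=> L0 SL; apply: sup_dist_le => // t t0 tT.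
  have [kL s0 st ts] := nu_grid T0 L0 t0 tT.
  set k := nu _ t in kL s0 st ts *.
  have -> : P t - S L k = (P t - P (k%:R * step T L)) + (P (k%:R * step T L) - S L k).
    by rewrite addrA subrK.
  apply: le_trans (ler_l1normD _ _) _; rewrite mulrDl lerD ?SL//.
  apply: le_trans (Plip _ _ s0 st tT) _; apply: le_trans (_ : cP' * (t - k%:R * step T L) <= _).
    by rewrite ler_wpM2r ?subr_ge0// le_max lexx.
  by rewrite ler_wpM2l// le_max lexx orbT.
have good : \forall L \near \oo, (0 < L)%N /\ forall k, (k <= L)%N ->
    l1norm (P (k%:R * step T L) - analysis_cov (Xa L) k) <= c * step T L /\
    l1norm (P (k%:R * step T L) - forecast_cov (Xa L) (Xf L) k) <= c * step T L.
  near=> L.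
  have L0 : (0 < L)%N by near: L; exists 1%N.
  split=> //; apply: err => //; first by near: L; exact: near_step_le.
  apply: le_trans (l1norm_le_opnorm _) _; rewrite -mulrA ler_wpM2l//.
  apply: (@le_trans _ _ (c0 * step T L)); last first.
    by rewrite ler_wpM2r ?le_max ?lexx// ltW// step_gt0.
  have : (`|(opnorm (P 0 - analysis_cov (Xa L) 0))%:E| <= (c0 * step T L)%:E)%E.
    by near: L.
  by rewrite abse_EFin lee_fin ger0_norm// opnorm_ge0.
split; exists (cP' + c); apply: filterS good => L [L0 errL].
  by apply: (grid (fun L => forecast_cov (Xa L) (Xf L))) => // k /errL[].
by apply: (grid (fun L => analysis_cov (Xa L))) => // k /errL[].
Unshelve. all: by end_near.
Qed.
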